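(* Let $d,m\ge 1$ be integers, and let $f,g:[0,\infty)\to[0,\infty)$ be nondecreasing functions such that $f$ is concave and $g$ is convex. If $A_1,\ldots,A_m$ are normal matrices in $\mathbb{M}_d$, then there exist unitary matrices $V_1,\ldots,V_d\in\mathbb{M}_d$ such that $$ (g\circ f)\left(\left|\sum_{k=1}^m A_k\right|\right)\le \frac{1}{d}\sum_{i=1}^d V_i\, g\left(\sum_{k=1}^m f(|A_k|)\right)V_i^*. $$
   Context: $\mathbb{M}_d$ is the space of complex $d\times d$ matrices. For $A\in\mathbb{M}_d$, $|A|=(A^*A)^{1/2}$. Functions of Hermitian matrices are defined by the usual spectral functional calculus. The inequality $X\le Y$ between Hermitian matrices is the usual (Loewner) order: $Y-X$ is positive semidefinite. *)

(* Defs.v *)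
From mathcomp Require Import all_boot all_order all_algebra.
From mathcomp Require Import sesquilinear spectral.
From mathcomp Require Import complex.
From mathcomp Require Import classical_sets set_interval reals convex.

Set Implicit Arguments.
Unset Strict Implicit.
Unset Printing Implicit Defensive.

Import Order.TTheory GRing.Theory Num.Theory.

Local Open Scope ring_scope.
Local Open Scope complex_scope.
Local Open Scope sesquilinear_scope.

(* Spectral functional calculus. [spectralmx A] is unitary and
   [A = invmx (spectralmx A) *m diag_mx (spectral_diag A) *m spectralmx A]
   whenever [A] is normal; for Hermitian [A] the diagonal entries are the real
   eigenvalues of [A], so that taking [complex.Re] loses nothing. The value is
   meaningful for Hermitian [A] only. *)
Definition funmx (R : realType) (d : nat) (h : R -> R) (A : 'M[R[i]]_d) :
    'M[R[i]]_d :=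
  invmx (spectralmx A)
  *m diag_mx (map_mx (fun z : R[i] => (h (complex.Re z))%:C) (spectral_diag A))
  *m spectralmx A.

Definition absmx (R : realType) (d : nat) (A : 'M[R[i]]_d) : 'M[R[i]]_d :=
  funmx (@Num.sqrt R) (A ^t* *m A).

(* On [R[i]], [0 <= z] means that [z] is real and nonnegative. *)
Definition psdmx (R : realType) (d : nat) (A : 'M[R[i]]_d) : Prop :=
  A \is hermsymmx /\ forall v : 'cV[R[i]]_d, 0 <= (v ^t* *m A *m v) 0 0.

Definition loewner_le (R : realType) (d : nat) (X Y : 'M[R[i]]_d) : Prop :=
  psdmx (Y - X).

(* The library only has convex functions. *)
Definition concave_function (R : realType) (D : set R) (f : R -> R) : Prop :=
  @convex_function R R^o D (fun x => - f x).

(* Main.v *)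
(* Write [S = \sum_k A_k] and [F = \sum_k f(|A_k|)]. For normal [A_k] with
   eigenvalues [al_i], phases [u_i] and orthonormal eigenvectors [e_i], the
   vectors [(e_i, u_i e_i) / sqrt 2] with the weights [|al_i|] define a positive
   operator on [C^d (+) C^d]; the sum [H] of these operators has eigenvalues
   dominating the singular values of [S]. If [p] is the orthogonal projection onto
   a line and [x p <= H], a supporting line of [f] at [x] and Chebyshev's
   association inequality give [tr (E (f(H) / H) x p) <= f(x) tr (E p)] for each
   spectral projection [E] of [H] onto its top eigenvalues. Summing over the
   lines and compressing [E] to the two halves of [C^d (+) C^d] yields the weak
   majorization of the eigenvalues of [f(|S|)] by those of [F], expressed as
   [\sum (x_j - t)_+ <= \sum (y_j - t)_+]. By a Schur-Horn construction, [F] is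
   orthogonally similar to a matrix whose diagonal dominates these eigenvalues;
   Jensen's inequality transfers this to [g(F)], and averaging over the [d]
   conjugations by [diag(w^(k i))_i], [w] a primitive [d]-th root of unity,
   kills the off-diagonal entries. *)
Require Import Defs.
From mathcomp Require Import all_boot all_order all_algebra.
From mathcomp Require Import sesquilinear spectral.
From mathcomp Require Import complex.
From mathcomp Require Import classical_sets set_interval reals convex.
From mathcomp Require Import interval_inference cyclic separable cyclotomic ring lra.

Set Implicit Arguments.
Unset Strict Implicit.
Unset Printing Implicit Defensive.

Import Order.TTheory GRing.Theory Num.Theory.

Local Open Scope ring_scope.
Local Open Scope complex_scope.
Local Open Scope sesquilinear_scope.

(** * Supporting lines of convex functions *)

Lemma convex_function_le (R : realType) (phi : R -> R) (x y t : R) :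
  @convex_function R R^o `[0, +oo[%classic phi ->
  0 <= x -> 0 <= y -> 0 <= t <= 1 ->
  phi (t * x + (1 - t) * y) <= t * phi x + (1 - t) * phi y.
Proof.
move=> cphi x0 y0 /andP[t0 t1].
have := cphi (Itv01 t0 t1) x y; rewrite !inE /= !in_itv /= !andbT.
by move/(_ x0 y0); rewrite !convRE.
Qed.

(** The slope is the supremum of the difference quotients to the left of [t], which are bounded by
    every quotient to the right. Positivity of [t] provides a left quotient, the one from [0]. *)
Lemma convex_support (R : realType) (phi : R -> R) (t : R) :
  @convex_function R R^o `[0, +oo[%classic phi -> 0 < t ->
  exists b, forall s, 0 <= s -> phi t + b * (s - t) <= phi s.
Proof.
move=> cphi t0.
have slope s u : 0 <= s -> s < t -> t < u ->
    (phi t - phi s) / (t - s) <= (phi u - phi t) / (u - t).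
  move=> s0 st tu; rewrite ler_pdivrMr ?subr_gt0 // mulrAC ler_pdivlMr ?subr_gt0 //.
  have su : 0 < u - s by lra.
  have l01 : 0 <= (u - t) / (u - s) <= 1.
    by apply/andP; split; [apply: divr_ge0; lra | rewrite ler_pdivrMr // mul1r; lra].
  have u0 : 0 <= u by lra.
  have := convex_function_le cphi s0 u0 l01.
  have -> : (u - t) / (u - s) * s + (1 - (u - t) / (u - s)) * u = t.
    by field; rewrite gt_eqF.
  rewrite -(ler_pM2r su).
  have -> : ((u - t) / (u - s) * phi s + (1 - (u - t) / (u - s)) * phi u) * (u - s)
     = (u - t) * phi s + (t - s) * phi u by field; rewrite gt_eqF.
  by lra.
pose E := [set z | exists2 s, 0 <= s < t & z = (phi t - phi s) / (t - s)]%classic.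
have Eub u : t < u -> ubound E ((phi u - phi t) / (u - t)).
  by move=> tu z [s /andP[s0 st] ->]; exact: slope.
have E0 : (E !=set0)%classic by exists ((phi t - phi 0) / (t - 0)), 0; rewrite ?lexx.
have hE : has_sup E.
  by split=> //; exists ((phi (t + 1) - phi t) / (t + 1 - t)); apply: Eub; lra.
exists (sup E) => s s0; case: (ltgtP s t) => [st|ts|->].
- have : (phi t - phi s) / (t - s) <= sup E.
    by apply: ub_le_sup; [case: hE | exists s; rewrite ?s0].
  by rewrite ler_pdivrMr ?subr_gt0 //; lra.
- have : sup E <= (phi s - phi t) / (s - t) by apply: ge_sup => //; exact: Eub.
  by rewrite ler_pdivlMr ?subr_gt0 //; lra.
- by rewrite subrr mulr0 addr0.
Qed.

(** * Counting, hinge sums and a Schur-Horn construction *)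

(** Greedy matching: the largest [a i] is paired with the largest [b j], which dominates it by the
    count at [s = a i]. Removing both lowers both counts by one for [s <= a i], and above [a i] the
    left count is zero. Unmatched [b j] contribute nonnegative terms. *)
Lemma ler_sum_count (R : realDomainType) (I J : finType) (A : {set I})
    (B : {set J}) (a : I -> R) (b : J -> R) (h : R -> R) :
  {in A, forall i, 0 <= a i} ->
  (forall s, 0 <= s -> (#|[set i in A | s <= a i]%R| <= #|[set j in B | s <= b j]%R|)%N) ->
  (forall s, 0 <= s -> 0 <= h s) -> {in B, forall j, 0 <= b j} ->
  (forall s t, 0 <= s -> s <= t -> h s <= h t) ->
  \sum_(i in A) h (a i) <= \sum_(j in B) h (b j).
Proof.
move: {2}(#|A|) (erefl #|A|) => n.
elim: n A B => [|n IH] A B cA a0 cnt h0 b0 hm.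
  by move/eqP: cA; rewrite cards_eq0 => /eqP->; rewrite big_set0 sumr_ge0 // => j /b0/h0.
have [i0 i0A] : exists i, i \in A by apply/card_gt0P; rewrite cA.
have [i iA imax] : exists2 i, i \in A & forall k, k \in A -> a k <= a i.
  by case: (Order.TotalTheory.arg_maxP a i0A) => i; exists i.
have [j0 /[!inE]/andP[j0B ij0]] : exists j, j \in [set j in B | a i <= b j].
  apply/card_gt0P; apply: leq_trans (cnt (a i) (a0 _ iA)); apply/card_gt0P.
  by exists i; rewrite !inE iA /=.
have [j jB jmax] : exists2 j, j \in B & forall k, k \in B -> b k <= b j.
  by case: (Order.TotalTheory.arg_maxP b j0B) => j; exists j.
have aibj : a i <= b j by apply: le_trans ij0 _; exact: jmax.
rewrite (big_setD1 i) //= (big_setD1 j jB) /=; apply: lerD.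
  by apply: hm => //; exact: a0.
apply: IH => //.
- by have := cardsD1 i A; rewrite iA cA => -[].
- by move=> k /setD1P[_ /a0].
- move=> s s0; have := cnt s s0.
  have [si|si] := leP s (a i).
    rewrite (cardsD1 i) (cardsD1 j [set _ in _ | _]) !inE iA jB si (le_trans si aibj) /=.
    rewrite !add1n ltnS; congr (_ <= _)%N; apply: eq_card => k;
    by rewrite !inE andbA.
  move=> _; rewrite eq_card0 // => k; rewrite !inE; apply/negP => /andP[/andP[_ kA]].
  by move=> /(lt_le_trans si); rewrite ltNge (imax k kA).
- by move=> k /setD1P[_ /b0].
Qed.

(** Induction step for [horn]: the top entry [m] leaves the first list, and the pair [p], [q] around
    it in the second list is replaced by [p + q - m]. As no [y j] lies strictly between [q] and [m],
    the [y] sum is affine for thresholds in between. *)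
Lemma hinge_step (R : realDomainType) (I J : finType) (x : I -> R) (y : J -> R)
    (m p q t : R) :
  (forall i, x i <= m) -> (forall j, m <= y j \/ y j <= q) ->
  q < m -> m <= p ->
  (forall s, Num.max 0 (m - s) + \sum_i Num.max 0 (x i - s) <=
     Num.max 0 (q - s) + Num.max 0 (p - s) + \sum_j Num.max 0 (y j - s)) ->
  \sum_i Num.max 0 (x i - t) <=
    Num.max 0 (p + q - m - t) + \sum_j Num.max 0 (y j - t).
Proof.
move=> xm ymq qm mp H.
have low s : s <= q -> \sum_i Num.max 0 (x i - s) <=
    p + q - m - s + \sum_j Num.max 0 (y j - s).
  move=> sq; have := H s.
  rewrite !max_r ?subr_ge0 //; [by lra|lra..].
have y0 : 0 <= \sum_j Num.max 0 (y j - t) by apply: sumr_ge0 => j _; rewrite le_max lexx.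
have z0 : 0 <= Num.max 0 (p + q - m - t) by rewrite le_max lexx.
have zt : p + q - m - t <= Num.max 0 (p + q - m - t) by rewrite le_max lexx orbT.
have [mt|tm] := leP m t.
  rewrite big1 ?addr_ge0 // => i _; rewrite max_l // subr_le0.
  by apply: le_trans mt.
have [tq|qt] := leP t q; first by apply: le_trans (low _ tq) _; rewrite lerD2r.
(* Here [q < t < m]. If [Nx <= Ny], the [y j] above [m] suffice on their own. Otherwise, raising the
   threshold from [q] to [t] lowers the left side by at least [Nx * (t - q)] and the right side,
   with its first term untruncated, by exactly [(Ny + 1) * (t - q)], so the bound at [q] carries
   over. *)
pose Nx := (\sum_i (t < x i)%R)%N; pose Ny := (\sum_j (m <= y j)%R)%N.
have eqy : \sum_j Num.max 0 (y j - q) =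
    \sum_j Num.max 0 (y j - t) + Ny%:R * (t - q).
  rewrite /Ny natr_sum big_distrl -big_split; apply: eq_bigr => j _ /=.
  case: (ymq j) => h.
    by rewrite h mul1r !max_r; lra.
  by rewrite !max_l; [rewrite leNgt (le_lt_trans h qm) /=|..]; lra.
have ley : Ny%:R * (m - t) <= \sum_j Num.max 0 (y j - t).
  rewrite /Ny natr_sum big_distrl; apply: ler_sum => j _ /=.
  have [h|h] := leP m (y j); last by rewrite mul0r le_max lexx.
  by rewrite mul1r max_r; lra.
have lex : \sum_i Num.max 0 (x i - t) <= Nx%:R * (m - t).
  rewrite /Nx natr_sum big_distrl; apply: ler_sum => i _ /=; have := xm i.
  have [h|h] := ltP t (x i); first by rewrite mul1r max_r; lra.
  by rewrite mul0r max_l; lra.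
have gex : \sum_i Num.max 0 (x i - t) + Nx%:R * (t - q) <= \sum_i Num.max 0 (x i - q).
  rewrite /Nx natr_sum big_distrl -big_split; apply: ler_sum => i _ /=.
  have [h|h] := ltP t (x i); first by rewrite mul1r !max_r; lra.
  by rewrite mul0r addr0 max_l; [rewrite le_max lexx | lra].
have [NN|NN] := leqP Nx Ny.
  have : Nx%:R * (m - t) <= Ny%:R * (m - t) by apply: ler_wpM2r; [lra | rewrite ler_nat].
  by lra.
have : (Ny%:R + 1) * (t - q) <= Nx%:R * (t - q).
  by apply: ler_wpM2r; [lra | rewrite natr1 ler_nat].
by have := low q (lexx q); lra.
Qed.

(* The construction of Chan and Li: a rotation in the plane of two adjacent
   [y p >= max x > y q] makes one diagonal entry equal to [max x]; the rest of
   the matrix is again diagonal, up to the row and column of that entry. *)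
Lemma horn (R : rcfType) (n : nat) (x y : 'I_n -> R) :
  (forall t, \sum_j Num.max 0 (x j - t) <= \sum_i Num.max 0 (y i - t)) ->
  exists U : 'M[R]_n, U^T *m U = 1%:M /\
    forall j, x j <= \sum_i U i j ^+ 2 * y i.
Proof.
elim: n x y => [|n IH] x y H.
  by exists 1%:M; split=> [|[]//]; rewrite mulmx1 trmx1.
have [j0 jmax] : exists j0, forall j, x j <= x j0.
  case: (Order.TotalTheory.arg_maxP x (erefl (xpredT (@ord0 n)))) => j _ hj.
  by exists j => k; exact: hj.
have [/forallP xy|] := boolP [forall i, x j0 <= y i].
  exists 1%:M; rewrite trmx1 mulmx1; split=> // j.
  rewrite (bigD1 j) //= big1 ?addr0 => [|i /negPf ij]; last first.
    by rewrite mxE ij expr0n mul0r.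
  by rewrite mxE eqxx expr1n mul1r (le_trans (jmax j)).
rewrite negb_forall => /existsP[q0]; rewrite -ltNge => hq0.
have [q [qm qmax]] : exists q, y q < x j0 /\ forall i, y i < x j0 -> y i <= y q.
  case: (@Order.TotalTheory.arg_maxP _ _ _ q0 (fun i => y i < x j0) y hq0).
  by move=> q hq hm; exists q.
have [p0 hp0] : exists p, x j0 <= y p.
  have [/existsP//|] := boolP [exists p, x j0 <= y p].
  rewrite negb_exists => /forallP hy; exfalso.
  (* At the threshold [y q] the right side would vanish, while [x j0] contributes a positive term on
     the left. *)
  have := H (y q); rewrite [leRHS]big1 => [|i _]; last first.
    by rewrite max_l // subr_le0 qmax // ltNge hy.
  apply/negP; rewrite -ltNge (bigD1 j0) //= ltr_pwDl //.
    by rewrite lt_max subr_gt0 qm orbT.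
  by apply: sumr_ge0 => j _; rewrite le_max lexx.
have [p [mp pmin]] : exists p, x j0 <= y p /\ forall i, x j0 <= y i -> y p <= y i.
  case: (@Order.TotalTheory.arg_minP _ _ _ p0 (fun i => x j0 <= y i) y hp0).
  by move=> p hp hm; exists p.
have qp : q != p by apply/eqP => qp; move: qm; rewrite qp ltNge mp.
have [p' ep] : exists p', p = lift q p'.
  by case: (unliftP q p) qp => [p' ->|->]; [exists p' | rewrite eqxx].
have sumE (F : 'I_n.+1 -> R) :
    \sum_i F i = F q + F p + \sum_(i | i != p') F (lift q i).
  by rewrite (bigD1_ord q) //= (bigD1 p') //= addrA -ep.
have sumxE (F : 'I_n.+1 -> R) : \sum_i F i = F j0 + \sum_i F (lift j0 i).
  by rewrite (bigD1_ord j0).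
(* The rotation preserves the trace of its 2 by 2 block, so [z] is the diagonal entry left beside
   [x j0]. *)
pose z := y p + y q - x j0.
pose y' i := if i == p' then z else y (lift q i).
have [|U' [U'1 U'x]] := IH (x \o lift j0) y'.
  move=> t; rewrite [leRHS](bigD1 p') //= {1}/y' eqxx.
  rewrite [X in _ <= _ + X](eq_bigr (fun i => Num.max 0 (y (lift q i) - t))); last first.
    by move=> i /negPf ip; rewrite /y' ip.
  pose J := {i : 'I_n | i != p'}.
  have sJ (F : 'I_n -> R) : \sum_(i | i != p') F i = \sum_(i : J) F (val i).
    rewrite (reindex_omap (val : J -> 'I_n) insub) => [|i ip]; last by rewrite insubT.
    by apply: eq_bigl => -[i ip] /=; rewrite insubT ip eqxx.
  rewrite sJ; apply: hinge_step => //.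
  - move=> [i ip] /=; have [h|h] := leP (x j0) (y (lift q i)); [by left|right; exact: qmax].
  - by move=> s; have := H s; rewrite [leLHS]sumxE [leRHS]sumE sJ.
pose d := y p - y q; have d0 : 0 < d by rewrite subr_gt0 (lt_le_trans qm).
pose c := Num.sqrt ((x j0 - y q) / d); pose s := Num.sqrt ((y p - x j0) / d).
have c2 : c ^+ 2 = (x j0 - y q) / d.
  by rewrite sqr_sqrtr //; apply: divr_ge0; [rewrite subr_ge0; exact: ltW | exact: ltW].
have s2 : s ^+ 2 = (y p - x j0) / d.
  by rewrite sqr_sqrtr //; apply: divr_ge0; [rewrite subr_ge0 | exact: ltW].
have cs1 : c ^+ 2 + s ^+ 2 = 1 by rewrite c2 s2 /d; field; rewrite gt_eqF.
have csx : s ^+ 2 * y q + c ^+ 2 * y p = x j0 by rewrite c2 s2 /d; field; rewrite gt_eqF.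
have csz : c ^+ 2 * y q + s ^+ 2 * y p = z by rewrite c2 s2 /z /d; field; rewrite gt_eqF.
(* Column [j0] is the unit vector with entries [s] at [q] and [c] at [p]. The other columns are
   those of [U'], with coordinate [p'] laid along the orthogonal vector with entries [c] at [q] and
   [- s] at [p]. *)
pose U : 'M[R]_n.+1 := \matrix_(i, j)
  match unlift j0 j, unlift q i with
  | None, None => s
  | None, Some i' => if i' == p' then c else 0
  | Some j', None => c * U' p' j'
  | Some j', Some i' => if i' == p' then - s * U' p' j' else U' i' j'
  end.
have Uq0 : U q j0 = s by rewrite mxE !unlift_none.
have Up0 : U p j0 = c by rewrite mxE unlift_none ep liftK eqxx.
have Ui0 i : i != p' -> U (lift q i) j0 = 0.
  by move=> /negPf ip; rewrite mxE unlift_none liftK ip.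
have Uqj j : U q (lift j0 j) = c * U' p' j by rewrite mxE liftK unlift_none.
have Upj j : U p (lift j0 j) = - s * U' p' j by rewrite mxE liftK ep liftK eqxx.
have Uij i j : i != p' -> U (lift q i) (lift j0 j) = U' i j.
  by move=> /negPf ip; rewrite mxE !liftK ip.
exists U; split.
  have U'E j k : \sum_i U' i j * U' i k = (j == k)%:R.
    by have /matrixP/(_ j k) := U'1; rewrite !mxE => <-; apply: eq_bigr => i _; rewrite mxE.
  apply/matrixP => j k; rewrite [LHS]mxE mxE.
  rewrite (eq_bigr (fun i => U i j * U i k)) => [|i _]; last by rewrite mxE.
  rewrite sumE; case: (unliftP j0 j) => [j'|] ->; case: (unliftP j0 k) => [k'|] ->.
  - rewrite (inj_eq lift_inj) -U'E [RHS](bigD1 p') //= !Uqj !Upj; congr (_ + _).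
      by rewrite -[RHS]mul1r -cs1; ring.
    by apply: eq_bigr => i ip; rewrite !Uij.
  - rewrite big1 => [|i ip]; last by rewrite Ui0 // mulr0.
    by rewrite Uqj Upj Uq0 Up0 eq_sym (negPf (neq_lift _ _)) mulr0n; ring.
  - rewrite big1 => [|i ip]; last by rewrite Ui0 // mul0r.
    by rewrite Uqj Upj Uq0 Up0 (negPf (neq_lift _ _)) mulr0n; ring.
  - rewrite big1 => [|i ip]; last by rewrite Ui0 // mul0r.
    by rewrite Uq0 Up0 eqxx addr0 mulr1n -cs1; ring.
move=> j; rewrite sumE; case: (unliftP j0 j) => [j'|] ->.
  apply: le_trans (U'x j') _; rewrite (bigD1 p') //= /y' eqxx Uqj Upj -csz.
  rewrite le_eqVlt; apply/orP; left; apply/eqP; congr (_ + _); first by ring.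
  by apply: eq_bigr => i ip; rewrite Uij // (negPf ip).
rewrite big1 => [|i ip]; last by rewrite Ui0 // expr0n mul0r.
by rewrite Uq0 Up0 addr0 csx.
Qed.

(** * Squared moduli, and concave functions on top eigenvalues *)

Definition normsq (R : rcfType) (z : R[i]) : R :=
  complex.Re z ^+ 2 + complex.Im z ^+ 2.

Lemma normsqE (R : rcfType) (z : R[i]) : (normsq z)%:C = z * Num.conj z.
Proof. by rewrite add_Re2_Im2 normCK. Qed.

Lemma normsq_ge0 (R : rcfType) (z : R[i]) : 0 <= normsq z.
Proof. by rewrite addr_ge0 // sqr_ge0. Qed.

Lemma normsq0 (R : rcfType) : normsq (0 : R[i]) = 0.
Proof. by rewrite /normsq /= expr0n addr0. Qed.

Lemma normsqM (R : rcfType) (z w : R[i]) : normsq (z * w) = normsq z * normsq w.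
Proof. by apply: complexI; rewrite [RHS]rmorphM /= !normsqE rmorphM; ring. Qed.

Lemma normsq_conj (R : rcfType) (z : R[i]) : normsq (Num.conj z) = normsq z.
Proof. by apply: complexI; rewrite !normsqE conjCK mulrC. Qed.

Lemma normsq_real (R : rcfType) (r : R) : normsq (r%:C) = r ^+ 2.
Proof. by rewrite /normsq /= expr0n addr0. Qed.

(** Monotonicity between [t] and [t + 1] makes the slope nonnegative. The line lies above [f 0 >= 0]
    at the origin, which is the bound [b * t <= f t]. *)
Lemma concave_support (R : realType) (f : R -> R) (t : R) :
  {in `[0, +oo[, forall x, 0 <= f x} ->
  {in `[0, +oo[ &, {homo f : x y / x <= y}} ->
  concave_function `[0, +oo[%classic f -> 0 < t ->
  exists b, [/\ 0 <= b, b * t <= f t &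
    forall s, 0 <= s -> f s <= f t + b * (s - t)].
Proof.
move=> f0 fm cf t0; have [b hb] := convex_support cf t0.
have hs s : 0 <= s -> f s <= f t + - b * (s - t) by move=> s0; have := hb s s0; lra.
exists (- b); split=> //.
  have := hs (t + 1) ltac:(lra).
  have : f t <= f (t + 1) by apply: fm; rewrite ?in_itv /= ?andbT; lra.
  by lra.
have := hs 0 (lexx 0); have : 0 <= f 0 by apply: f0; rewrite in_itv /= lexx.
by lra.
Qed.

(* Chebyshev's association inequality: [c] is larger on [T] than off [T], so
   the harmonic mean of [c] over [T] is at least its global harmonic mean. *)
Lemma chebyshev_inv (R : realFieldType) (I : finType) (T : {set I})
    (nu c : I -> R) (x : R) :
  (forall l, 0 <= nu l) -> (forall l, 0 <= c l) -> \sum_l nu l = 1 -> 0 <= x ->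
  (forall l, c l = 0 -> nu l = 0) -> x * (\sum_l nu l / c l) <= 1 ->
  {in T, forall l, 0 < c l} -> {in T & [predC T], forall l k, c k <= c l} ->
  x * (\sum_(l in T) nu l / c l) <= \sum_(l in T) nu l.
Proof.
move=> nu0 c0 nu1 x0 nuc xle cT Ttop.
have [/forall_inP xc|] := boolP [forall l in T, x <= c l].
  rewrite mulr_sumr; apply: ler_sum => l lT; rewrite mulrCA ler_piMr //.
  by rewrite ler_pdivrMr ?cT // mul1r xc.
rewrite negb_forall => /existsP[l0]; rewrite negb_imply -ltNge => /andP[l0T cx].
(* Some [c l0] with [l0] in [T] is below [x], hence so is every [c l] off [T]. The reverse
   inequality thus holds off [T] and is subtracted from the total. *)
have nT : \sum_(l | l \notin T) nu l <= x * \sum_(l | l \notin T) nu l / c l.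
  rewrite mulr_sumr; apply: ler_sum => l lT.
  have [cl|cl] := eqVneq (c l) 0; first by rewrite nuc // mul0r mulr0.
  have {cl}cl : 0 < c l by rewrite lt_def cl c0.
  rewrite mulrCA ler_peMr // ler_pdivlMr // mul1r.
  by apply: ltW; apply: le_lt_trans cx; apply: Ttop.
rewrite (bigID (mem T)) mulrDr /= in xle.
rewrite (bigID (mem T)) /= in nu1.
by lra.
Qed.

(** The hypothesis on [w] says that the sum of the projections onto the unit vectors [eta i],
    weighted by [x i], is diagonal with eigenvalues [c] in the chosen coordinates. Each [f (c l)] is
    split as [f (c l) / c l] times [c l], and [c l] is expanded over the lines, so that one line is
    estimated at a time. *)
Lemma concave_top (R : realType) (n : nat) (I : finType) (f : R -> R)
    (c : 'I_n -> R) (x : I -> R) (eta : I -> 'I_n -> R[i]) (T : {set 'I_n}) :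
  {in `[0, +oo[, forall x, 0 <= f x} ->
  {in `[0, +oo[ &, {homo f : x y / x <= y}} ->
  concave_function `[0, +oo[%classic f ->
  (forall i, 0 <= x i) -> (forall l, 0 <= c l) ->
  (forall i, \sum_l normsq (eta i l) = 1) ->
  (forall w : 'I_n -> R[i],
    \sum_i x i * normsq (\sum_l w l * Num.conj (eta i l)) =
    \sum_l c l * normsq (w l)) ->
  {in T, forall l, 0 < c l} -> {in T & [predC T], forall l k, c k <= c l} ->
  \sum_(l in T) f (c l) <= \sum_i f (x i) * \sum_(l in T) normsq (eta i l).
Proof.
move=> f0 fm cf x0 c0 eta1 quad cT Ttop.
have cE l : c l = \sum_i x i * normsq (eta i l).
  have := quad (fun k => (k == l)%:R); rewrite (bigD1 l) //= eqxx.
  rewrite [\sum_(i < n | _) _]big1 => [|k /negPf->]; last by rewrite normsq0 mulr0.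
  rewrite addr0 (_ : normsq 1 = 1) ?mulr1; last by rewrite (normsq_real 1) expr1n.
  move=> <-; apply: eq_bigr => i _; congr (_ * _); rewrite (bigD1 l) //= eqxx mul1r.
  by rewrite big1 ?addr0 ?normsq_conj // => k /negPf->; rewrite mul0r.
have nuc i l : 0 < x i -> c l = 0 -> normsq (eta i l) = 0.
  move=> xi cl; apply/eqP; rewrite eq_le normsq_ge0 andbT -(ler_pM2l xi) mulr0.
  rewrite -[leRHS]cl cE (bigD1 i) //= lerDl sumr_ge0 // => k _.
  by rewrite mulr_ge0 ?normsq_ge0.
(* Testing [quad] at [eta i / c], the image of [eta i] under the pseudo-inverse, bounds
   [x i * q ^+ 2] by [q]. Entries with [c l = 0] contribute nothing, since [0^-1 = 0]. *)
have dom i : x i * (\sum_l normsq (eta i l) / c l) <= 1.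
  set q := \sum_l _.
  have q0 : 0 <= q by apply: sumr_ge0 => l _; rewrite divr_ge0 ?normsq_ge0.
  have xqq : x i * q ^+ 2 <= q.
    have := quad (fun l => eta i l * ((c l)^-1)%:C).
    have -> : \sum_l c l * normsq (eta i l * ((c l)^-1)%:C) = q.
      apply: eq_bigr => l _; rewrite normsqM normsq_real.
      have [->|cl] := eqVneq (c l) 0; first by rewrite invr0 mul0r mulr0.
      by field.
    move=> qE; rewrite -[leRHS]qE (bigD1 i) //= -(normsq_real q).
    rewrite (_ : real_complex R q = \sum_l eta i l * ((c l)^-1)%:C * Num.conj (eta i l)).
      by rewrite lerDl sumr_ge0 // => k _; rewrite mulr_ge0 ?normsq_ge0.
    rewrite rmorph_sum; apply: eq_bigr => l _.
    by rewrite [LHS]rmorphM /= normsqE; ring.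
  have [->|qN0] := eqVneq q 0; first by rewrite mulr0.
  have qp : 0 < q by rewrite lt_def qN0.
  by rewrite -(ler_pM2r qp) mul1r -mulrA -expr2.
have -> : \sum_(l in T) f (c l) =
    \sum_i \sum_(l in T) f (c l) / c l * (x i * normsq (eta i l)).
  rewrite exchange_big; apply: eq_bigr => l lT /=.
  by rewrite -mulr_sumr -cE divfK // gt_eqF ?cT.
apply: ler_sum => i _.
have [xi|xi] := eqVneq (x i) 0.
  rewrite big1 => [|l _]; last by rewrite xi mul0r mulr0.
  by rewrite mulr_ge0 ?f0 ?in_itv /= ?x0 ?sumr_ge0 // => l _; exact: normsq_ge0.
have {}xi : 0 < x i by rewrite lt_def xi x0.
have [b [b0 bx hb]] := concave_support f0 fm cf xi.
have cheb := chebyshev_inv (fun l => normsq_ge0 (eta i l)) c0 (eta1 i) (x0 i)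
  (fun l => nuc i l xi) (dom i) cT Ttop.
(* The supporting line at [x i] has the value [g >= 0] at the origin. Its linear part gives an exact
   term, and its constant part is bounded by Chebyshev's inequality. *)
set g := f (x i) - b * x i.
have g0 : 0 <= g by rewrite subr_ge0.
apply: (@le_trans _ _ (b * x i * (\sum_(l in T) normsq (eta i l))
   + g * (x i * \sum_(l in T) normsq (eta i l) / c l))).
  rewrite !mulr_sumr -big_split; apply: ler_sum => l lT /=.
  have -> : b * x i * normsq (eta i l) + g * (x i * (normsq (eta i l) / c l))
      = (b * c l + g) / c l * (x i * normsq (eta i l)).
    by field; rewrite gt_eqF ?cT.
  rewrite ler_wpM2r ?mulr_ge0 ?normsq_ge0 // ler_wpM2r ?invr_ge0 //.
  by have := hb (c l) (c0 l); rewrite /g; lra.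
have -> : f (x i) = b * x i + g by rewrite /g; ring.
by rewrite [leRHS]mulrDl lerD2l ler_wpM2l.
Qed.

(** * Spectral decompositions, compressions and orthonormal rows *)

(** For unitary [P] this is a spectral decomposition in the convention of [funmx]. Rectangular [P]
    is allowed so that weighted sums of rank-one operators on the doubled space have the same
    form. *)
Definition specmx (C : numClosedFieldType) (p d : nat) (P : 'M[C]_(p, d))
    (r : 'rV[C]_p) : 'M[C]_d :=
  P^t* *m diag_mx r *m P.

Lemma trmxCE (C : numClosedFieldType) (m n : nat) (M : 'M[C]_(m, n)) i j :
  (M^t*) i j = Num.conj (M j i).
Proof. by rewrite !mxE. Qed.

Lemma mul_mx_diagE (C : numClosedFieldType) (m n : nat) (M : 'M[C]_(m, n))
    (r : 'rV[C]_n) i j :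
  (M *m diag_mx r) i j = M i j * r 0 j.
Proof. by rewrite mul_mx_diag mxE. Qed.

Lemma trmxC_mul (C : numClosedFieldType) (m n p : nat) (M : 'M[C]_(m, n))
    (N : 'M[C]_(n, p)) :
  (M *m N)^t* = N^t* *m M^t*.
Proof. by rewrite trmx_mul map_mxM. Qed.

Lemma unitarymx_mulV (C : numClosedFieldType) (n : nat) (P : 'M[C]_n) :
  P \is unitarymx -> P^t* *m P = 1%:M.
Proof. by move=> Pu; rewrite -invmx_unitary // mulVmx // unitarymx_unit. Qed.

Lemma trmxC_specmx (C : numClosedFieldType) (p d : nat) (P : 'M[C]_(p, d))
    (r : 'rV[C]_p) :
  (forall i, Num.conj (r 0 i) = r 0 i) -> (specmx P r)^t* = specmx P r.
Proof.
move=> rr; have diagE : (diag_mx r)^t* = diag_mx r.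
  apply/matrixP => i j; rewrite !mxE rmorphMn /= eq_sym rr.
  by have [->|] := eqVneq i j; rewrite ?mulr1n ?mulr0n.
by rewrite /specmx !trmxC_mul trmxCK diagE mulmxA.
Qed.

Lemma specmx_trmxC_mul (C : numClosedFieldType) (d : nat) (P : 'M[C]_d) (r : 'rV[C]_d) :
  P \is unitarymx ->
  (specmx P r)^t* *m specmx P r = specmx P (\row_i (Num.conj (r 0 i) * r 0 i)).
Proof.
move=> Pu; rewrite {1}/specmx !trmxC_mul trmxCK /specmx !mulmxA.
rewrite -[_ *m P *m P^t*]mulmxA (unitarymxP Pu) mulmx1 -[_ *m diag_mx r]mulmxA.
suff -> : (diag_mx r)^t* *m diag_mx r = diag_mx (\row_i (Num.conj (r 0 i) * r 0 i)) by [].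
apply/matrixP => i j; rewrite mul_mx_diagE trmxCE !mxE rmorphMn /= eq_sym.
by have [->|ij] := eqVneq i j; rewrite ?mulr1n // !mulr0n mul0r.
Qed.

(* The change of basis between two diagonalizations only links equal
   eigenvalues, so the functional calculus does not depend on the choice. *)
Lemma specmx_map (C : numClosedFieldType) (d : nat) (P Q : 'M[C]_d)
    (r s : 'rV[C]_d) (h : C -> C) :
  P \is unitarymx -> Q \is unitarymx -> specmx P r = specmx Q s ->
  specmx P (map_mx h r) = specmx Q (map_mx h s).
Proof.
move=> Pu Qu PQ; pose W := P *m Q^t*.
have WE : W *m diag_mx s = diag_mx r *m W.
  have : P *m specmx P r *m Q^t* = P *m specmx Q s *m Q^t* by rewrite PQ.
  rewrite /specmx !mulmxA (unitarymxP Pu) mul1mx => PQE.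
  by rewrite /W -[LHS](mulmxtVK _ Qu) -PQE.
have WEh : W *m diag_mx (map_mx h s) = diag_mx (map_mx h r) *m W.
  rewrite !mul_mx_diag !mul_diag_mx in WE *.
  apply/matrixP => i j; have /matrixP/(_ i j) := WE.
  rewrite !mxE mulrC; set w := \sum_(_ | _) _.
  have [->|w0] := eqVneq w 0; first by rewrite !mul0r !mulr0.
  by move=> /(mulIf w0) sr; rewrite sr mulrC.
rewrite -[LHS]mulmx1 -(unitarymx_mulV Qu) /specmx.
have := congr1 (fun X => P^t* *m X *m Q) WEh.
by rewrite /W !mulmxA (unitarymx_mulV Pu) mul1mx => <-.
Qed.

Lemma specmx_quad (C : numClosedFieldType) (q p d : nat) (V : 'M[C]_(q, d))
    (P : 'M[C]_(p, d)) (r : 'rV[C]_p) (j : 'I_q) :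
  (V *m specmx P r *m V^t*) j j = \sum_i r 0 i * `|(V *m P^t*) j i| ^+ 2.
Proof.
have -> : V *m specmx P r *m V^t* = V *m P^t* *m diag_mx r *m (V *m P^t*)^t*.
  by rewrite trmxC_mul trmxCK /specmx !mulmxA.
rewrite mul_mx_diag mxE; apply: eq_bigr => i _.
by rewrite normCK !mxE mulrCA mulrA.
Qed.

Lemma mul_trmxC_diag (C : numClosedFieldType) (m n : nat) (w : 'M[C]_(m, n)) (i : 'I_m) :
  (w *m w^t*) i i = \sum_l `|w i l| ^+ 2.
Proof. by rewrite mxE; apply: eq_bigr => l _; rewrite normCK !mxE. Qed.

Lemma unitarymx_row_norm (C : numClosedFieldType) (m n : nat) (V : 'M[C]_(m, n))
    (j : 'I_m) :
  V \is unitarymx -> \sum_l `|V j l| ^+ 2 = 1.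
Proof. by move=> /unitarymxP VV; rewrite -mul_trmxC_diag VV mxE eqxx. Qed.

(** The residual [w - u *m V] of the projection onto the rows of [V] has nonnegative squared
    norm. *)
Lemma bessel (C : numClosedFieldType) (q m n : nat) (V : 'M[C]_(q, n))
    (w : 'M[C]_(m, n)) (i : 'I_m) :
  V \is unitarymx ->
  \sum_l `|(w *m V^t*) i l| ^+ 2 <= \sum_l `|w i l| ^+ 2.
Proof.
move=> /unitarymxP VV; set u := w *m V^t*.
have uE : V *m w^t* = u^t* by rewrite trmxC_mul trmxCK.
have DE : (w - u *m V) *m (w - u *m V)^t* = w *m w^t* - u *m u^t*.
  have -> : (w - u *m V)^t* = w^t* - V^t* *m u^t*.
    by rewrite -trmxC_mul linearB /= map_mxB.
  rewrite mulmxBl !mulmxBr !mulmxA -/u -[u *m V *m w^t*]mulmxA uE.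
  by rewrite -[u *m V *m V^t*]mulmxA VV mulmx1 subrr subr0.
rewrite -!mul_trmxC_diag -subr_ge0.
have -> : (w *m w^t*) i i - (u *m u^t*) i i = ((w - u *m V) *m (w - u *m V)^t*) i i.
  by rewrite DE [RHS]mxE [X in _ = _ + X]mxE.
by rewrite mul_trmxC_diag sumr_ge0 // => l _; rewrite exprn_ge0.
Qed.

Lemma parseval (C : numClosedFieldType) (m n : nat) (V : 'M[C]_n)
    (w : 'M[C]_(m, n)) (i : 'I_m) :
  V \is unitarymx ->
  \sum_l `|(w *m V^t*) i l| ^+ 2 = \sum_l `|w i l| ^+ 2.
Proof.
move=> Vu; rewrite -!mul_trmxC_diag trmxC_mul trmxCK.
by rewrite mulmxA -[w *m _ *m _]mulmxA unitarymx_mulV // mulmx1.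
Qed.

(** Dimension count: [#|J|] free coordinates against [#|L|] linear equations. It yields in
    [weyl_count] a combination of test vectors orthogonal to the eigenvectors of large
    eigenvalue. *)
Lemma kernel_support (F : fieldType) (p q : nat) (M : 'M[F]_(p, q))
    (J : {set 'I_p}) (L : {set 'I_q}) :
  (#|L| < #|J|)%N ->
  exists2 b : 'rV[F]_p, b != 0 &
    (forall j, j \notin J -> b 0 j = 0) /\ {in L, forall l, (b *m M) 0 l = 0}.
Proof.
move=> LJ; pose N := \matrix_(a < #|J|, c < #|L|) M (enum_val a) (enum_val c).
have : kermx N != 0.
  by rewrite -mxrank_eq0 mxrank_ker subn_eq0 -ltnNge (leq_ltn_trans (rank_leq_col _)).
case/rowV0Pn => v /sub_kermxP vN v0.
pose b := v *m rowsub (fun a : 'I_#|J| => enum_val a) 1%:M.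
exists b; last split.
- apply: contraNneq v0 => b0; apply/eqP/rowP => a.
  have /rowP/(_ (enum_val a)) := b0; rewrite !mxE (bigD1 a) //= !mxE eqxx mulr1.
  rewrite big1 ?addr0 // => c ca; rewrite !mxE.
  by rewrite (inj_eq (@enum_val_inj _ _)) (negPf ca) mulr0.
- move=> j jJ; rewrite mxE big1 // => a _; rewrite !mxE.
  case: eqP => [aj|_]; last by rewrite mulr0.
  by move: jJ; rewrite -aj enum_valP.
move=> l lL; rewrite /b -mulmxA mul_rowsub_mx mul1mx mxE.
have /rowP/(_ (enum_rank_in lL l)) vNl := vN.
transitivity ((v *m N) 0 (enum_rank_in lL l)); last by rewrite vNl mxE.
by rewrite [RHS]mxE; apply: eq_bigr => a _; rewrite !mxE enum_rankK_in.
Qed.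

(** Gram-Schmidt on a basis of the row space; [W^t* *m W] is the orthogonal projection onto that
    space. *)
Lemma row_orthonormal_basis (C : numClosedFieldType) (p n : nat) (M : 'M[C]_(p, n)) :
  exists q (W : 'M[C]_(q, n)), [/\ (q <= p)%N, W \is unitarymx & M *m W^t* *m W = M].
Proof.
have proj q (W : 'M[C]_(q, n)) :
    W \is unitarymx -> (M <= W)%MS -> M *m W^t* *m W = M.
  by move=> Wu /submxP[X ->]; rewrite mulmxtVK.
have Wu : schmidt (row_base M) \is unitarymx.
  by apply: schmidt_unitarymx; exact: rank_leq_col.
exists (\rank M), (schmidt (row_base M)); split=> //; first exact: rank_leq_row.
by apply: proj => //; rewrite eqmx_schmidt_free ?row_base_free // eq_row_base.
Qed.

(** * The dilation to the doubled space *)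

(** The rows are the adjoints of the vectors $(e_i, u_i e_i)/\sqrt 2$, with $e_i$ the columns of
    [P^t*]; hence the conjugate on [u]. *)
Definition dilmx (C : numClosedFieldType) (d : nat) (P : 'M[C]_d) (u : 'rV[C]_d) :
    'M[C]_(d, d + d) :=
  (sqrtC 2)^-1 *: row_mx P (diag_mx (map_mx Num.conj u) *m P).

Lemma dilmx_trmxC (C : numClosedFieldType) (d : nat) (P : 'M[C]_d) (u : 'rV[C]_d) :
  (dilmx P u)^t* = (sqrtC 2)^-1 *: col_mx (P^t*) (P^t* *m diag_mx u).
Proof.
have sE : Num.conj ((sqrtC 2)^-1 : C) = (sqrtC 2)^-1.
  by apply/CrealP; rewrite realV ger0_real // sqrtC_ge0.
apply/matrixP => i j; rewrite !mxE rmorphM /= sE; congr (_ * _).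
case: (splitP i) => k ik; rewrite !mxE // rmorph_sum; apply: eq_bigr => l _.
rewrite !mxE rmorphM rmorphMn /= conjCK mulrC; congr (_ * _).
by have [->|] := eqVneq l j; rewrite ?eqxx // => /negPf lj; rewrite eq_sym lj.
Qed.

Lemma dilmx_unitary (C : numClosedFieldType) (d : nat) (P : 'M[C]_d) (u : 'rV[C]_d) :
  P \is unitarymx -> (forall i, `|u 0 i| = 1) -> dilmx P u \is unitarymx.
Proof.
move=> /unitarymxP Pu u1; apply/unitarymxP; rewrite dilmx_trmxC /dilmx.
rewrite -scalemxAl -scalemxAr scalerA mul_row_col !mulmxA Pu.
rewrite -[_ *m P *m P^t*]mulmxA Pu mulmx1 -invfM -expr2 sqrtCK.
apply/matrixP => i j; rewrite mul_diag_mx !mxE.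
have [->|ij] := eqVneq i j; last by rewrite !mulr0n mulr0 addr0 mulr0.
by rewrite !mulr1n [Num.conj _ * _]mulrC -normCK u1 expr1n mulVf ?pnatr_eq0.
Qed.

(** Termwise this is $4\,\mathrm{Re}(\eta\bar\xi) \le |\xi+\eta|^2$, with difference $|\xi-\eta|^2$.
    The left side is the form of the Hermitian matrix with zero diagonal blocks and off-diagonal
    blocks [specmx P al] and its adjoint. *)
Lemma dilmx_ge (C : numClosedFieldType) (d : nat) (P : 'M[C]_d) (u a al : 'rV[C]_d)
    (x y : 'rV[C]_d) :
  (forall i, `|u 0 i| = 1) -> (forall i, 0 <= a 0 i) ->
  (forall i, al 0 i = a 0 i * u 0 i) ->
  (y *m specmx P al *m x^t*) 0 0 + Num.conj ((y *m specmx P al *m x^t*) 0 0) <=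
  (row_mx x y *m specmx (dilmx P u) a *m (row_mx x y)^t*) 0 0.
Proof.
move=> u1 a0 alE; rewrite specmx_quad dilmx_trmxC -scalemxAr mul_row_col.
pose X := x *m P^t*; pose Y := y *m P^t*.
have -> : (y *m specmx P al *m x^t*) 0 0 = \sum_i a 0 i * (Y 0 i * u 0 i * Num.conj (X 0 i)).
  have -> : y *m specmx P al *m x^t* = Y *m diag_mx al *m X^t*.
    by rewrite /X /Y trmxC_mul trmxCK /specmx !mulmxA.
  rewrite mxE; apply: eq_bigr => i _; rewrite mul_mx_diagE trmxCE alE; ring.
rewrite rmorph_sum -big_split; apply: ler_sum => i _ /=.
have sumE (z : C) : (z *: (X + Y *m diag_mx u)) 0 i = z * (X 0 i + Y 0 i * u 0 i).
  by rewrite mxE [E in _ * E = _]mxE mul_mx_diagE.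
rewrite mulmxA -/X -/Y sumE.
set xi := X 0 i; set yi := Y 0 i.
rewrite [Num.conj (_ * _)]rmorphM /= (CrealP (ger0_real (a0 i))) -mulrDr.
apply: ler_wpM2l => //; rewrite normrM exprMn.
have -> : `|(sqrtC 2)^-1 : C| ^+ 2 = 2^-1.
  by rewrite normfV exprVn ger0_norm ?sqrtC_ge0 // sqrtCK.
rewrite [leRHS]mulrC ler_pdivlMr ?ltr0n // -subr_ge0.
have -> : `|xi + yi * u 0 i| ^+ 2 - (yi * u 0 i * Num.conj xi +
   Num.conj (yi * u 0 i * Num.conj xi)) * 2 = `|xi - yi * u 0 i| ^+ 2.
  by rewrite !normCK !(rmorphD, rmorphM, rmorphN) /= conjCK; ring.
by rewrite exprn_ge0.
Qed.

(* Eigenvalues of the dilation dominate the singular values of [S]: compare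
   them on the span of the vectors [(x_j, S x_j / sigma_j)], where the [x_j]
   are right singular vectors. *)
Lemma weyl_count (C : numClosedFieldType) (d : nat) (S Q : 'M[C]_d)
    (sg : 'rV[C]_d) (Z : 'M[C]_(d + d)) (c : 'rV[C]_(d + d)) (s : C) :
  Q \is unitarymx -> Z \is unitarymx -> 0 < s ->
  (forall j, 0 <= sg 0 j) -> (forall l, 0 <= c 0 l) ->
  S^t* *m S = specmx Q (map_mx (fun z => z ^+ 2) sg) ->
  (forall x y : 'rV[C]_d,
    (y *m S *m x^t*) 0 0 + Num.conj ((y *m S *m x^t*) 0 0) <=
    (row_mx x y *m specmx Z c *m (row_mx x y)^t*) 0 0) ->
  (#|[set j | s <= sg 0 j]%R| <= #|[set l | s <= c 0 l]%R|)%N.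
Proof.
move=> Qu Zu s0 sg0 c0 SS dil; rewrite leqNgt; apply/negP => cnt.
pose Di := diag_mx (map_mx GRing.inv sg).
pose G := row_mx Q (Di *m Q *m S^t*).
have [b bN0 [bJ bL]] := kernel_support (G *m Z^t*) cnt.
have bsg j : b 0 j != 0 -> s <= sg 0 j.
  by apply: contraR => sj; rewrite bJ ?inE.
pose N := \sum_j `|b 0 j| ^+ 2.
have N0 : 0 < N.
  have [j bj] : exists j, b 0 j != 0 by apply/rV0Pn.
  rewrite /N (bigD1 j) //= ltr_pwDl ?exprn_gt0 ?normr_gt0 //.
  by apply: sumr_ge0 => k _; rewrite exprn_ge0.
pose x := b *m Q; pose y := b *m Di *m Q *m S^t*.
have wE : row_mx x y = b *m G by rewrite /x /y mul_mx_row !mulmxA.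
have QSSQ : Q *m (S^t* *m S) *m Q^t* = diag_mx (map_mx (fun z => z ^+ 2) sg).
  by rewrite SS /specmx !mulmxA (unitarymxP Qu) mul1mx mulmxtVK.
have DiC : Di^t* = Di.
  apply/matrixP => i j; rewrite trmxCE !mxE rmorphMn /= fmorphV /= eq_sym.
  have [->|//] := eqVneq i j; by rewrite (CrealP (ger0_real (sg0 j))).
have xx : \sum_l `|x 0 l| ^+ 2 = N.
  by rewrite /x -{1}[Q]trmxCK parseval // trmxC_unitary.
have yE : y *m y^t* = b *m Di *m (Q *m (S^t* *m S) *m Q^t*) *m Di *m b^t*.
  by rewrite /y !trmxC_mul trmxCK DiC !mulmxA.
have ySxE : y *m S *m x^t* = b *m Di *m (Q *m (S^t* *m S) *m Q^t*) *m b^t*.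
  by rewrite /y /x !trmxC_mul !mulmxA.
have yy : \sum_l `|y 0 l| ^+ 2 = N.
  rewrite -mul_trmxC_diag yE QSSQ mxE; apply: eq_bigr => j _.
  rewrite !mul_mx_diagE trmxCE !mxE normCK.
  have [->|/bsg sj] := eqVneq (b 0 j) 0; first by rewrite !mul0r.
  by have sN := gt_eqF (lt_le_trans s0 sj); field; rewrite sN.
have ySx : (y *m S *m x^t*) 0 0 = \sum_j sg 0 j * `|b 0 j| ^+ 2.
  rewrite ySxE QSSQ mxE; apply: eq_bigr => j _.
  rewrite !mul_mx_diagE trmxCE !mxE normCK.
  have [->|/bsg sj] := eqVneq (b 0 j) 0; first by rewrite !(mul0r, mulr0).
  by have sN := gt_eqF (lt_le_trans s0 sj); field; rewrite sN.
have lower : s * N <= (y *m S *m x^t*) 0 0.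
  rewrite ySx mulr_sumr; apply: ler_sum => j _.
  have [->|/bsg sj] := eqVneq (b 0 j) 0; first by rewrite normr0 expr0n !mulr0.
  by rewrite ler_wpM2r ?exprn_ge0.
have := dil x y; rewrite (CrealP (ger0_real (le_trans (mulr_ge0 (ltW s0) (ltW N0)) lower))).
move=> /(le_trans (lerD lower lower)); rewrite wE specmx_quad.
(* The vector [w] has squared norm [N + N] and, by the choice of [b], only components with
   [c 0 l < s]. Its form is then strictly below [s * (N + N)], against the lower bound just
   obtained. *)
set w := b *m G *m Z^t*.
have ww : \sum_l `|w 0 l| ^+ 2 = N + N.
  rewrite /w parseval // -wE -{1}xx -yy big_split_ord /=.
  by congr (_ + _); apply: eq_bigr => l _; rewrite ?row_mxEl ?row_mxEr.
have wL l : s <= c 0 l -> w 0 l = 0.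
  by move=> sl; rewrite /w -mulmxA bL // inE.
have [l wl] : exists l, w 0 l != 0.
  apply/rV0Pn; apply: contraTneq (addr_gt0 N0 N0) => w0.
  by rewrite -ww w0 big1 ?ltxx // => l _; rewrite mxE normr0 expr0n.
have cs k : w 0 k != 0 -> c 0 k < s.
  rewrite real_ltNge ?ger0_real ?(ltW s0) //; exact: contra_neqN (wL k).
rewrite -mulrDr -ww mulr_sumr => /le_gtF/negbT/negP; apply.
rewrite (bigD1 l) //= [ltRHS](bigD1 l) //=; apply: ltr_leD.
  by rewrite ltr_pM2r ?cs // exprn_gt0 // normr_gt0.
apply: ler_sum => k _.
have [->|wk] := eqVneq (w 0 k) 0; first by rewrite normr0 expr0n !mulr0.
by rewrite ler_wpM2r ?exprn_ge0 // ltW // cs.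
Qed.

(* The projection onto selected rows of [Z] is dominated by the block diagonal
   projection onto the spans of the two halves of these rows, whose blocks
   have at most as large a rank. *)
Lemma dilmx_top (C : numClosedFieldType) (d : nat) (Z : 'M[C]_(d + d))
    (T : {set 'I_(d + d)}) :
  Z \is unitarymx ->
  exists q1 q2 (W1 : 'M[C]_(q1, d)) (W2 : 'M[C]_(q2, d)),
    [/\ (q1 <= #|T|)%N, (q2 <= #|T|)%N, W1 \is unitarymx, W2 \is unitarymx &
     forall (P : 'M[C]_d) (u : 'rV[C]_d) i, (forall i, `|u 0 i| = 1) ->
       \sum_(l in T) `|(dilmx P u *m Z^t*) i l| ^+ 2 <=
       2^-1 * (\sum_q `|(P *m W1^t*) i q| ^+ 2 + \sum_q `|(P *m W2^t*) i q| ^+ 2)].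
Proof.
move=> /unitarymxP ZZ.
pose ZT := rowsub (fun a : 'I_#|T| => enum_val a) Z.
have ZTu : ZT \is unitarymx.
  apply/unitarymxP/matrixP => a b; rewrite mxE [RHS]mxE.
  have /matrixP/(_ (enum_val a) (enum_val b)) := ZZ.
  rewrite mxE [RHS]mxE (inj_eq (@enum_val_inj _ _)) => <-.
  by apply: eq_bigr => l _; rewrite !trmxCE !mxE.
have [q1 [W1 [q1T W1u W1E]]] := row_orthonormal_basis (lsubmx ZT).
have [q2 [W2 [q2T W2u W2E]]] := row_orthonormal_basis (rsubmx ZT).
exists q1, q2, W1, W2; split=> // P u i u1.
pose W := block_mx W1 0 0 W2.
have Wt : W^t* = block_mx (W1^t*) 0 0 (W2^t*).
  by rewrite tr_block_mx map_block_mx !trmx0 !map_mx0.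
have WW : W *m W^t* = 1%:M.
  rewrite Wt mulmx_block !mulmx0 !mul0mx !addr0 !add0r.
  by rewrite (unitarymxP W1u) (unitarymxP W2u) -scalar_mx_block.
have ZTW : ZT *m W^t* *m W = ZT.
  rewrite -[ZT]hsubmxK Wt mul_row_block !mulmx0 addr0 add0r.
  by rewrite mul_row_block !mulmx0 addr0 add0r W1E W2E.
set D := dilmx P u.
have -> : \sum_(l in T) `|(D *m Z^t*) i l| ^+ 2 = \sum_a `|(D *m ZT^t*) i a| ^+ 2.
  rewrite big_enum_val; apply: eq_bigr => a _; congr (`|_| ^+ 2).
  by rewrite !mxE; apply: eq_bigr => l _; rewrite !trmxCE !mxE.
(* The rows of [ZT] lie in the row space of [W], so projecting [D] there first changes nothing;
   Bessel's inequality then removes [ZT]. *)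
have -> : D *m ZT^t* = D *m W^t* *m W *m ZT^t*.
  by rewrite -{1}ZTW !trmxC_mul trmxCK !mulmxA.
apply: le_trans (bessel _ _ ZTu) _.
rewrite -mul_trmxC_diag trmxC_mul mulmxA -[D *m _ *m W *m _]mulmxA WW mulmx1.
rewrite mul_trmxC_diag big_split_ord /= mulrDr.
have s2 : `|(sqrtC 2)^-1 : C| ^+ 2 = 2^-1.
  by rewrite normfV exprVn ger0_norm ?sqrtC_ge0 // sqrtCK.
have DW : D *m W^t* = (sqrtC 2)^-1 *: row_mx (P *m W1^t*)
     (diag_mx (map_mx Num.conj u) *m (P *m W2^t*)).
  by rewrite /D /dilmx -scalemxAl Wt mul_row_block !mulmx0 addr0 add0r mulmxA.
rewrite DW !mulr_sumr le_eqVlt; apply/orP; left; apply/eqP; congr (_ + _).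
  by apply: eq_bigr => q _; rewrite mxE row_mxEl normrM exprMn s2.
apply: eq_bigr => q _; rewrite mxE row_mxEr normrM exprMn s2; congr (_ * _).
by rewrite mul_diag_mx mxE mxE normrM exprMn norm_conjC u1 expr1n mul1r.
Qed.

(** * Averaging over diagonal unitaries *)

(** In characteristic zero $X^n - 1$ is separable, hence has [n] distinct roots, and among [n]
    distinct [n]-th roots of unity one is primitive. *)
Lemma closed_prim_root (C : numClosedFieldType) (n : nat) :
  (0 < n)%N -> exists z : C, n.-primitive_root z.
Proof.
move=> n_gt0; pose p : {poly C} := 'X^n - 1; have [r Dp] := closed_field_poly_normal p.
rewrite (monicP _) ?monicXnsubC // scale1r in Dp.
have rn1 : all n.-unity_root r by apply/allP=> z; rewrite -root_prod_XsubC -Dp.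
have sz_r : (n < (size r).+1)%N by rewrite -(size_prod_XsubC r id) -Dp size_XnsubC.
have [|z] := hasP (has_prim_root n_gt0 rn1 _ sz_r); last by exists z.
by rewrite -separable_prod_XsubC -Dp separable_Xn_sub_1 // pnatr_eq0 -lt0n.
Qed.

(** Averaging multiplies entry [i, j] by the mean of the powers of [z ^+ i / z ^+ j], a geometric
    sum that vanishes off the diagonal because [z] is primitive. *)
Lemma pinching (C : numClosedFieldType) (d : nat) (Y : 'M[C]_d) :
  (0 < d)%N ->
  exists w : 'I_d -> 'rV[C]_d, (forall k, diag_mx (w k) \is unitarymx) /\
    d%:R^-1 *: \sum_k (diag_mx (w k) *m Y *m (diag_mx (w k))^t*) =
    diag_mx (\row_i Y i i).
Proof.
move=> d0; have [z zp] := closed_prim_root C d0.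
have z1 : `|z| = 1.
  by apply/eqP; rewrite -(pexpr_eq1 d0) // -normrX (prim_expr_order zp) normr1.
have z0 : z != 0 by rewrite -normr_eq0 z1 oner_eq0.
have zC n : Num.conj (z ^+ n) = (z ^+ n)^-1.
  by rewrite invC_norm normrX z1 !expr1n invr1 mul1r.
exists (fun k => \row_i z ^+ (k * i)); split=> [k|].
  apply/unitarymxP/matrixP => i j; rewrite mul_diag_mx [LHS]mxE trmxCE !mxE.
  have [->|ij] := eqVneq i j; last by rewrite mulr0n rmorph0 mulr0.
  by rewrite mulr1n zC mulfV // expf_neq0.
apply/matrixP => i j; rewrite mxE summxE !mxE.
have -> : \sum_(k < d) (diag_mx (\row_(a < d) z ^+ (k * a)) *m Y *m
     (diag_mx (\row_(a < d) z ^+ (k * a)))^t*) i j =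
   Y i j * \sum_(k < d) (z ^+ i / z ^+ j) ^+ k.
  rewrite mulr_sumr; apply: eq_bigr => k _.
  have -> : (diag_mx (\row_(a < d) z ^+ (k * a)))^t* =
      diag_mx (\row_(a < d) (z ^+ (k * a))^-1).
    apply/matrixP => a b; rewrite trmxCE !mxE rmorphMn /= zC eq_sym.
    by have [->|//] := eqVneq a b.
  rewrite mul_mx_diagE mul_diag_mx !mxE exprMn -!exprM exprVn -exprM.
  by rewrite ![(_ * k)%N]mulnC; ring.
have [->|ij] := eqVneq i j.
  rewrite mulr1n mulfV ?expf_neq0 // (eq_bigr (fun=> 1)) => [|k _]; last by rewrite expr1n.
  by rewrite sumr_const card_ord mulrCA mulVf ?mulr1 // pnatr_eq0 -lt0n.
rewrite mulr0n; set t := z ^+ i / z ^+ j.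
have t1 : t != 1.
  apply: contra ij => /eqP/(congr1 ( *%R^~ (z ^+ j))).
  rewrite divfK ?expf_neq0 // mul1r => /eqP.
  by rewrite (eq_prim_root_expr zp) !modn_small.
have td : t ^+ d = 1.
  rewrite exprMn exprVn -!exprM ![(_ * d)%N]mulnC !exprM (prim_expr_order zp).
  by rewrite !expr1n invr1 mulr1.
have : (t - 1) * (\sum_(k < d) t ^+ k) = 0 by rewrite -subrX1 td subrr.
by move/eqP; rewrite mulf_eq0 subr_eq0 (negPf t1) /= => /eqP->; rewrite !mulr0.
Qed.

Lemma specmx_ge0 (C : numClosedFieldType) (p d : nat) (Q : 'M[C]_(p, d))
    (r : 'rV[C]_p) (v : 'cV[C]_d) :
  (forall i, 0 <= r 0 i) -> 0 <= (v^t* *m specmx Q r *m v) 0 0.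
Proof.
move=> r0; rewrite -[v in X in 0 <= X]trmxCK trmxCK specmx_quad.
by apply: sumr_ge0 => i _; rewrite mulr_ge0 ?exprn_ge0.
Qed.

(** Each [V k] passes to the eigenbasis [B], rotates by [U^t*], applies the pinching phases and
    moves to the basis [Q]. After averaging, both terms are diagonal in the same basis and can be
    compared entrywise. *)
Lemma unitary_average (C : numClosedFieldType) (d : nat) (Q B U : 'M[C]_d)
    (x y : 'rV[C]_d) :
  (0 < d)%N -> Q \is unitarymx -> B \is unitarymx -> U \is unitarymx ->
  exists V : 'I_d -> 'M[C]_d, (forall k, V k \is unitarymx) /\
    d%:R^-1 *: \sum_k (V k *m specmx B y *m (V k)^t*) - specmx Q x =
    specmx Q (\row_j (\sum_i y 0 i * `|U i j| ^+ 2 - x 0 j)).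
Proof.
move=> d0 Qu Bu Uu; pose Y := U^t* *m diag_mx y *m U.
have [w [wu wY]] := pinching Y d0.
have Qtu : Q^t* \is unitarymx by rewrite trmxC_unitary.
have Utu : U^t* \is unitarymx by rewrite trmxC_unitary.
exists (fun k => Q^t* *m (diag_mx (w k) *m (U^t* *m B))); split.
  by move=> k; rewrite !mul_unitarymx.
have VE k : Q^t* *m (diag_mx (w k) *m (U^t* *m B)) *m specmx B y *m
    (Q^t* *m (diag_mx (w k) *m (U^t* *m B)))^t* =
    Q^t* *m (diag_mx (w k) *m Y *m (diag_mx (w k))^t*) *m Q.
  rewrite !trmxC_mul !trmxCK /specmx /Y !mulmxA; congr (_ *m _ *m _).
  rewrite -[_ *m B *m B^t*]mulmxA (unitarymxP Bu) mulmx1.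
  by rewrite -[_ *m B *m B^t*]mulmxA (unitarymxP Bu) mulmx1.
rewrite (eq_bigr _ (fun k _ => VE k)) -mulmx_suml -mulmx_sumr.
rewrite scalemxAl scalemxAr wY /specmx -mulmxBl -mulmxBr.
have -> : diag_mx (\row_i Y i i) - diag_mx x =
    diag_mx (\row_j (\sum_i y 0 i * `|U i j| ^+ 2 - x 0 j)); last by [].
rewrite -linearB; congr diag_mx; apply/rowP => j; rewrite [LHS]mxE [RHS]mxE.
congr (_ + _); last by rewrite mxE.
have := specmx_quad (U^t*) 1%:M y j; rewrite /specmx !trmxCK trmx1 map_mx1.
rewrite mul1mx !mulmx1 => YE; rewrite mxE YE; apply: eq_bigr => i _.
by rewrite trmxCE norm_conjC.
Qed.

(** * Functional calculus with real spectra *)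

Definition rowC (R : rcfType) (n : nat) (r : 'I_n -> R) : 'rV[R[i]]_n :=
  \row_i (r i)%:C.

Lemma sum_normsq (R : rcfType) (I : Type) (s : seq I) (A : pred I) (F : I -> R[i]) :
  (\sum_(l <- s | A l) normsq (F l))%:C = \sum_(l <- s | A l) `|F l| ^+ 2.
Proof. by rewrite rmorph_sum; apply: eq_bigr => l _; exact: add_Re2_Im2. Qed.

Lemma specmx_quadR (R : rcfType) (q p d : nat) (V : 'M[R[i]]_(q, d))
    (P : 'M[R[i]]_(p, d)) (r : 'I_p -> R) (j : 'I_q) :
  (V *m specmx P (rowC r) *m V^t*) j j =
  (\sum_i r i * normsq ((V *m P^t*) j i))%:C.
Proof.
rewrite specmx_quad rmorph_sum; apply: eq_bigr => i _.
by rewrite [RHS]rmorphM /= mxE add_Re2_Im2.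
Qed.

Lemma rowC_real (R : rcfType) (n : nat) (r : 'I_n -> R) i :
  Num.conj (rowC r 0 i) = rowC r 0 i.
Proof. by rewrite mxE; exact: conjc_real. Qed.

Lemma normal_specmx (R : rcfType) (d : nat) (A : 'M[R[i]]_d) :
  A \is normalmx -> A = specmx (spectralmx A) (spectral_diag A).
Proof.
move=> An; rewrite /specmx -invmx_unitary ?spectral_unitarymx //.
exact/orthomx_spectralP.
Qed.

Lemma selfadj_hermsymmx (R : rcfType) (d : nat) (A : 'M[R[i]]_d) :
  A^t* = A -> A \is hermsymmx.
Proof. by move=> hA; apply/is_hermitianmxP; rewrite expr0 scale1r hA. Qed.

Lemma selfadj_specmx (R : rcfType) (d : nat) (A : 'M[R[i]]_d) :
  A^t* = A ->
  A = specmx (spectralmx A) (rowC (fun i => complex.Re (spectral_diag A 0 i))).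
Proof.
move=> /selfadj_hermsymmx hA.
have -> : rowC (fun i => complex.Re (spectral_diag A 0 i)) = spectral_diag A.
  apply/rowP => i; rewrite mxE RRe_real //.
  by have /mxOverP/(_ 0 i) := hermitian_spectral_diag_real hA.
by apply: normal_specmx; exact: hermitian_normalmx.
Qed.

(** Frees [funmx] from the particular [spectralmx] in its definition: any unitary diagonalization
    may be used. *)
Lemma funmx_specmx (R : realType) (d : nat) (h : R -> R) (P : 'M[R[i]]_d)
    (r : 'I_d -> R) :
  P \is unitarymx -> funmx h (specmx P (rowC r)) = specmx P (rowC (h \o r)).
Proof.
move=> Pu; set A := specmx P (rowC r).
have An : A \is normalmx.
  by apply/hermitian_normalmx/selfadj_hermsymmx/trmxC_specmx; exact: rowC_real.
have E : rowC (h \o r) = map_mx (fun z : R[i] => (h (complex.Re z))%:C) (rowC r).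
  by apply/rowP => i; rewrite !mxE.
rewrite E (specmx_map _ Pu (spectral_unitarymx A) (normal_specmx An)).
by rewrite /funmx /specmx invmx_unitary ?spectral_unitarymx.
Qed.

Lemma absmx_specmx (R : realType) (d : nat) (P : 'M[R[i]]_d) (al : 'rV[R[i]]_d) :
  P \is unitarymx ->
  absmx (specmx P al) = specmx P (rowC (fun i => Num.sqrt (normsq (al 0 i)))).
Proof.
move=> Pu; rewrite /absmx.
have -> : (specmx P al)^t* *m specmx P al = specmx P (rowC (fun i => normsq (al 0 i))).
  have E : rowC (fun i => normsq (al 0 i)) = \row_i (Num.conj (al 0 i) * al 0 i).
    by apply/rowP => i; rewrite !mxE normsqE mulrC.
  by rewrite E; exact: specmx_trmxC_mul.
by rewrite funmx_specmx.
Qed.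

(** * Weak majorization of the eigenvalues, and Jensen's inequality *)

(** A Ky Fan bound: the trace of the compression to the rows of [W] is the sum of the [y b] with
    weights [kap b] in $[0,1]$ of total [q <= N]. Each [kap b * (y b - t)] is at most the positive
    part of [y b - t]. *)
Lemma compression_hinge (R : rcfType) (d m q N : nat) (P : 'I_m -> 'M[R[i]]_d)
    (r : 'I_m -> 'I_d -> R) (B : 'M[R[i]]_d) (y : 'I_d -> R)
    (W : 'M[R[i]]_(q, d)) (t : R) :
  B \is unitarymx -> W \is unitarymx -> (q <= N)%N -> 0 <= t ->
  \sum_k specmx (P k) (rowC (r k)) = specmx B (rowC y) ->
  \sum_k \sum_i r k i * \sum_j normsq ((P k *m W^t*) i j) - N%:R * t <=
  \sum_b Num.max 0 (y b - t).
Proof.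
move=> Bu Wu qN t0 PB.
pose kap b := \sum_j normsq ((W *m B^t*) j b).
have -> : \sum_k \sum_i r k i * \sum_j normsq ((P k *m W^t*) i j) = \sum_b y b * kap b.
  transitivity (\sum_j \sum_b y b * normsq ((W *m B^t*) j b)); last first.
    by rewrite exchange_big; apply: eq_bigr => b _; rewrite mulr_sumr.
  transitivity (\sum_j \sum_k \sum_i r k i * normsq ((P k *m W^t*) i j)).
    rewrite [RHS]exchange_big; apply: eq_bigr => k _ /=.
    by rewrite [RHS]exchange_big; apply: eq_bigr => i _ /=; rewrite mulr_sumr.
  apply: eq_bigr => j _; apply: complexI.
  rewrite -specmx_quadR -PB mulmx_sumr mulmx_suml summxE rmorph_sum.
  apply: eq_bigr => k _; rewrite specmx_quadR; congr (_%:C).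
  apply: eq_bigr => i _; congr (_ * _).
  by rewrite -normsq_conj -trmxCE trmxC_mul trmxCK.
have kap0 b : 0 <= kap b by apply: sumr_ge0 => j _; exact: normsq_ge0.
have kap1 b : kap b <= 1.
  rewrite -lecR; have := bessel B b Wu; rewrite (unitarymx_row_norm _ Bu).
  rewrite -sum_normsq; apply: le_trans; rewrite lecR.
  apply: ler_sum => j _.
  by rewrite -normsq_conj -trmxCE trmxC_mul trmxCK.
have kapN : \sum_b kap b <= N%:R.
  have -> : \sum_b kap b = q%:R.
    rewrite exchange_big (eq_bigr (fun=> 1)) /= ?sumr_const ?card_ord // => j _.
    apply: complexI; rewrite sum_normsq parseval // unitarymx_row_norm //.
  by rewrite ler_nat.
apply: (@le_trans _ _ (\sum_b kap b * (y b - t))).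
  have -> : \sum_b kap b * (y b - t) = \sum_b y b * kap b - (\sum_b kap b) * t.
    rewrite mulr_suml -sumrB; apply: eq_bigr => b _; ring.
  by rewrite lerD2l lerN2 ler_wpM2r.
apply: ler_sum => b _; rewrite le_max.
have [h|h] := leP 0 (y b - t); first by rewrite ler_piMl // orbT.
by rewrite mulr_ge0_le0 // ltW.
Qed.

(** A supporting line of [g] at [x] is averaged with the weights [w]. Its slope is nonnegative by
    monotonicity, so the excess of the mean over [x] only helps. *)
Lemma jensen_nondecreasing (R : realType) (n : nat) (g : R -> R) (w y : 'I_n -> R) (x : R) :
  {in `[0, +oo[ &, {homo g : x y / x <= y}} ->
  @convex_function R R^o `[0, +oo[%classic g ->
  (forall i, 0 <= w i) -> \sum_i w i = 1 -> (forall i, 0 <= y i) -> 0 <= x ->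
  x <= \sum_i w i * y i -> g x <= \sum_i w i * g (y i).
Proof.
move=> gm cg w0 w1 y0 x0 xy.
have gle a b : 0 <= a -> a <= b -> g a <= g b.
  by move=> a0 ab; apply: gm; rewrite ?in_itv /= ?andbT // (le_trans a0).
have [b hb] : exists b, forall s, 0 <= s ->
    g x + b * (s - x) <= g s /\ 0 <= b * (\sum_i w i * y i - x).
  (* At the origin, where [convex_support] does not apply, monotonicity gives a horizontal
     supporting line. *)
  have [->|xN0] := eqVneq x 0.
    exists 0 => s s0; rewrite !mul0r addr0; split=> //; exact: gle.
  have xp : 0 < x by rewrite lt_def xN0.
  have [b hb] := convex_support cg xp; exists b => s s0; split; first exact: hb.
  apply: mulr_ge0; last by rewrite subr_ge0.
  have := hb 0 (lexx 0); have := gle 0 x (lexx 0) x0; rewrite sub0r => g0 gb.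
  by rewrite -(pmulr_lge0 _ xp); lra.
apply: (@le_trans _ _ (\sum_i w i * (g x + b * (y i - x)))); last first.
  by apply: ler_sum => i _; rewrite ler_wpM2l //; exact: (hb _ (y0 i)).1.
have -> : \sum_i w i * (g x + b * (y i - x)) =
   (\sum_i w i) * (g x - b * x) + b * \sum_i w i * y i.
  by rewrite mulr_suml mulr_sumr -big_split; apply: eq_bigr => i _ /=; ring.
by have [_] := hb 0 (lexx 0); rewrite w1; lra.
Qed.

(** The bound [f 0 <= t] makes [t] nonnegative and ensures that eigenvalues of the dilation with
    [f (c l) > t] are positive, so that division by them is legitimate. *)
Lemma concave_hinge (R : realType) (d m : nat) (f : R -> R)
    (P : 'I_m -> 'M[R[i]]_d) (al : 'I_m -> 'rV[R[i]]_d) (Q B : 'M[R[i]]_d)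
    (sg y : 'I_d -> R) (t : R) :
  let S := \sum_k specmx (P k) (al k) in
  let a k i := Num.sqrt (normsq (al k 0 i)) in
  {in `[0, +oo[, forall x, 0 <= f x} ->
  {in `[0, +oo[ &, {homo f : x y / x <= y}} ->
  concave_function `[0, +oo[%classic f ->
  (forall k, P k \is unitarymx) -> Q \is unitarymx -> B \is unitarymx ->
  (forall j, 0 <= sg j) ->
  S^t* *m S = specmx Q (rowC (fun j => sg j ^+ 2)) ->
  \sum_k specmx (P k) (rowC (fun i => f (a k i))) = specmx B (rowC y) ->
  f 0 <= t ->
  \sum_j Num.max 0 (f (sg j) - t) <= \sum_b Num.max 0 (y b - t).
Proof.
move=> S a f0 fm cf Pu Qu Bu sg0 SS FB ft.
have t0 : 0 <= t by apply: le_trans ft; apply: f0; rewrite in_itv /= lexx.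
have fle x z : 0 <= x -> x <= z -> f x <= f z.
  by move=> x0 xz; apply: fm; rewrite ?in_itv /= ?andbT // (le_trans x0).
have a0 k i : 0 <= a k i by exact: sqrtr_ge0.
have aE k i : (a k i)%:C = `|al k 0 i|.
  by rewrite /a normc_def.
(* The phase of a zero eigenvalue is set to [1], so that all phases are unimodular. *)
pose u k : 'rV[R[i]]_d := \row_i (if al k 0 i == 0 then 1 else al k 0 i / `|al k 0 i|).
have u1 k i : `|u k 0 i| = 1.
  rewrite mxE; case: eqVneq => [_|aN0]; first exact: normr1.
  by rewrite normrM normfV normr_id mulfV // normr_eq0.
have alE k i : al k 0 i = rowC (a k) 0 i * u k 0 i.
  rewrite !mxE aE; case: eqVneq => [->|aN0]; first by rewrite normr0 mul0r.
  by rewrite mulrC divfK // normr_eq0.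
pose D k := dilmx (P k) (u k).
have Du k : D k \is unitarymx by exact: (dilmx_unitary (Pu k) (u1 k)).
pose Cm := \sum_k specmx (D k) (rowC (a k)).
have CmC : Cm^t* = Cm.
  rewrite /Cm linear_sum /= map_mx_sum; apply: eq_bigr => k _.
  by apply: trmxC_specmx; exact: rowC_real.
pose Z := spectralmx Cm; have Zu : Z \is unitarymx by exact: spectral_unitarymx.
pose c l := complex.Re (spectral_diag Cm 0 l).
have CmE : Cm = specmx Z (rowC c) by exact: selfadj_specmx.
have quad q (w : 'M[R[i]]_(q, d + d)) j :
    \sum_k \sum_i a k i * normsq ((w *m (D k)^t*) j i) =
    \sum_l c l * normsq ((w *m Z^t*) j l).
  apply: complexI; rewrite -[RHS]specmx_quadR -CmE mulmx_sumr mulmx_suml summxE.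
  by rewrite rmorph_sum; apply: eq_bigr => k _; rewrite specmx_quadR.
have c0 l : 0 <= c l.
  have -> : c l = \sum_k \sum_i a k i * normsq ((Z *m (D k)^t*) l i).
    rewrite quad (unitarymxP Zu) (bigD1 l) //= big1 => [|i il].
      by rewrite mxE eqxx (normsq_real 1) expr1n mulr1 addr0.
    by rewrite mxE eq_sym (negPf il) normsq0 mulr0.
  by apply: sumr_ge0 => k _; apply: sumr_ge0 => i _; rewrite mulr_ge0 ?normsq_ge0.
pose I : finType := ('I_m * 'I_d)%type.
pose eta (ki : I) l := (D ki.1 *m Z^t*) ki.2 l.
(* As [f] is nondecreasing, [T] selects top eigenvalues of [Cm]. *)
pose T := [set l | t < f (c l)].
have step1 : \sum_j Num.max 0 (f (sg j) - t) <= \sum_(l in T) (f (c l) - t).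
  have -> : \sum_(l in T) (f (c l) - t) = \sum_l Num.max 0 (f (c l) - t).
    rewrite [LHS]big_mkcond; apply: eq_bigr => l _; rewrite inE.
    by case: ltP => h; [rewrite max_r | rewrite max_l]; rewrite ?subr_ge0 ?subr_le0 // ltW.
  have setTE n (F : 'I_n -> R) : \sum_j F j = \sum_(j in [set: 'I_n]) F j.
    by apply: eq_bigl => j; rewrite inE.
  rewrite !setTE; apply: (ler_sum_count (h := fun s => Num.max 0 (f s - t))) => //.
  (* At [s = 0] all [d] indices are compared with all [d + d]; [weyl_count] covers positive [s]. *)
  - move=> s; rewrite le_eqVlt => /predU1P[<-|s0].
      apply: leq_trans (max_card _) _; rewrite card_ord.
      rewrite (_ : [set j in _ | _] = [set: 'I_(d + d)]) ?cardsT ?card_ord ?leq_addr //.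
      by apply/setP => l; rewrite !inE c0.
    have := @weyl_count _ d S Q (rowC sg) Z (rowC c) s%:C Qu Zu.
    rewrite ltcR => /(_ s0).
    have -> : [set j in [set: 'I_d] | s <= sg j] = [set j | s%:C <= rowC sg 0 j].
      by apply/setP => j; rewrite !inE mxE lecR.
    have -> : [set j in [set: 'I_(d + d)] | s <= c j] = [set j | s%:C <= rowC c 0 j].
      by apply/setP => j; rewrite !inE mxE lecR.
    apply.
    + by move=> j; rewrite mxE ler0c.
    + by move=> j; rewrite mxE ler0c.
    + rewrite SS; congr specmx; apply/rowP => j; rewrite !mxE.
      exact: rmorphXn.
    + move=> x z; rewrite -CmE /S mulmx_sumr mulmx_suml summxE rmorph_sum -big_split.
      rewrite /Cm mulmx_sumr mulmx_suml summxE; apply: ler_sum => k _.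
      apply: dilmx_ge => [i|i|i]; [exact: u1 | by rewrite mxE ler0c | exact: alE].
  - by move=> s _; rewrite le_max lexx.
  - move=> s s' s0 ss'; rewrite ge_max !le_max lexx /= lerD2r fle ?orbT //.
apply: le_trans step1 _.
rewrite sumrB sumr_const -mulr_natl.
have step2 : \sum_(l in T) f (c l) <=
    \sum_(ki : I) f (a ki.1 ki.2) * \sum_(l in T) normsq (eta ki l).
  apply: (concave_top f0 fm cf (x := fun ki : I => a ki.1 ki.2)) => //.
  - move=> ki; apply: complexI; rewrite sum_normsq parseval //.
    by rewrite (unitarymx_row_norm _ (Du _)).
  - move=> w; pose wr : 'rV[R[i]]_(d + d) := \row_l w l.
    have := quad _ (wr *m Z) 0; rewrite -mulmxA (unitarymxP Zu) mulmx1.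
    rewrite pair_big /= => E; transitivity (\sum_l c l * normsq (wr 0 l)); last first.
      by apply: eq_bigr => l _; rewrite mxE.
    rewrite -E; apply: eq_bigr => -[k i] _ /=; congr (_ * normsq _).
    rewrite -mulmxA mxE; apply: eq_bigr => l _; rewrite mxE; congr (_ * _).
    by rewrite /eta /= -trmxCE trmxC_mul trmxCK.
  - move=> l; rewrite inE => tl; rewrite lt_def c0 andbT; apply: contraTneq tl => ->.
    by rewrite -leNgt.
  - move=> l k; rewrite !inE -leNgt => tl kt; rewrite leNgt; apply/negP => lk.
    by have := lt_le_trans tl (le_trans (fle _ _ (c0 l) (ltW lk)) kt); rewrite ltxx.
have [q1 [q2 [W1 [W2 [q1T q2T W1u W2u top]]]]] := dilmx_top T Zu.
have step3 (ki : I) : \sum_(l in T) normsq (eta ki l) <=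
    2^-1 * (\sum_q normsq ((P ki.1 *m W1^t*) ki.2 q) +
            \sum_q normsq ((P ki.1 *m W2^t*) ki.2 q)).
  have := top (P ki.1) (u ki.1) ki.2 (u1 ki.1).
  rewrite -!sum_normsq -[2]/(2%:R) -(rmorph_nat (real_complex R)).
  by rewrite -fmorphV -rmorphD -rmorphM lecR.
(* Both compressions have rank at most [#|T|]. The mean of the two bounds, each charged with
   [#|T| * t], matches the factor one half of the dilation. *)
have h1 := compression_hinge Bu W1u q1T t0 FB.
have h2 := compression_hinge Bu W2u q2T t0 FB.
have step4 : \sum_(ki : I) f (a ki.1 ki.2) * \sum_(l in T) normsq (eta ki l) <=
    2^-1 * (\sum_k \sum_i f (a k i) * \sum_q normsq ((P k *m W1^t*) i q) +
            \sum_k \sum_i f (a k i) * \sum_q normsq ((P k *m W2^t*) i q)).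
  rewrite !pair_big -big_split mulr_sumr; apply: ler_sum => ki _ /=.
  rewrite -mulrDr mulrCA ler_wpM2l ?f0 ?in_itv /= ?a0 //; exact: step3.
move: h1 h2 step4 step2; lra.
Qed.


(** * From hinge inequalities to the Loewner bound *)

Theorem theorem2p4 (R : realType) (d m : nat) (f g : R -> R)
    (A : 'I_m -> 'M[R[i]]_d) :
  (1 <= d)%N -> (1 <= m)%N ->
  {in `[0, +oo[, forall x, 0 <= f x} ->
  {in `[0, +oo[, forall x, 0 <= g x} ->
  {in `[0, +oo[ &, {homo f : x y / x <= y}} ->
  {in `[0, +oo[ &, {homo g : x y / x <= y}} ->
  concave_function `[0, +oo[%classic f ->
  @convex_function R R^o `[0, +oo[%classic g ->
  (forall k, A k \is normalmx) ->
  exists V : 'I_d -> 'M[R[i]]_d,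
    (forall i, V i \is unitarymx) /\
    loewner_le
      (funmx (g \o f) (absmx (\sum_(k < m) A k)))
      (d%:R^-1 *:
        \sum_(i < d) (V i *m funmx g (\sum_(k < m) funmx f (absmx (A k)))
                          *m (V i) ^t*)).
Proof.
move=> d0 m0 f0 g0 fm gm cf cg An.
have fle x z : 0 <= x -> x <= z -> f x <= f z.
  by move=> x0 xz; apply: fm; rewrite ?in_itv /= ?andbT // (le_trans x0).
have fge0 x : 0 <= x -> 0 <= f x by move=> x0; apply: f0; rewrite in_itv /= x0.
pose P k := spectralmx (A k); pose al k := spectral_diag (A k).
have Pu k : P k \is unitarymx by exact: spectral_unitarymx.
have AE k : A k = specmx (P k) (al k) by exact: normal_specmx.
pose S := \sum_k specmx (P k) (al k).
have SE : \sum_(k < m) A k = S by apply: eq_bigr => k _; exact: AE.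
pose a k i := Num.sqrt (normsq (al k 0 i)).
pose F := \sum_k specmx (P k) (rowC (fun i => f (a k i))).
have FE : \sum_(k < m) funmx f (absmx (A k)) = F.
  apply: eq_bigr => k _; rewrite AE absmx_specmx //.
  exact: funmx_specmx.
have FC : F^t* = F.
  rewrite /F linear_sum /= map_mx_sum; apply: eq_bigr => k _.
  by apply: trmxC_specmx; exact: rowC_real.
pose B := spectralmx F; have Bu : B \is unitarymx by exact: spectral_unitarymx.
pose y b := complex.Re (spectral_diag F 0 b).
have FB : F = specmx B (rowC y) by exact: selfadj_specmx.
pose S2 := S^t* *m S.
have S2C : S2^t* = S2 by rewrite /S2 trmxC_mul trmxCK.
pose Q := spectralmx S2; have Qu : Q \is unitarymx by exact: spectral_unitarymx.
pose s j := complex.Re (spectral_diag S2 0 j).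
have S2E : S2 = specmx Q (rowC s) by exact: selfadj_specmx.
have rowE (r : 'I_d -> R) (U : 'M[R[i]]_d) j : U \is unitarymx ->
    (U *m specmx U (rowC r) *m U^t*) j j = (r j)%:C.
  move=> Uu; rewrite specmx_quadR (unitarymxP Uu) (bigD1 j) //= big1 => [|i ij].
    by rewrite mxE eqxx (normsq_real 1) expr1n mulr1 addr0.
  by rewrite mxE eq_sym (negPf ij) normsq0 mulr0.
have s0 j : 0 <= s j.
  rewrite -ler0c -(rowE s Q j Qu) -S2E.
  have -> : Q *m S2 *m Q^t* = (Q *m S^t*) *m (Q *m S^t*)^t*.
    by rewrite /S2 trmxC_mul trmxCK !mulmxA.
  by rewrite mul_trmxC_diag sumr_ge0 // => l _; rewrite exprn_ge0.
pose sg j := Num.sqrt (s j).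
have sg0 j : 0 <= sg j by exact: sqrtr_ge0.
have SS : S^t* *m S = specmx Q (rowC (fun j => sg j ^+ 2)).
  rewrite -/S2 S2E; congr specmx; apply/rowP => j; rewrite !mxE.
  by rewrite sqr_sqrtr.
have yE b : y b = \sum_k \sum_i f (a k i) * normsq ((B *m (P k)^t*) b i).
  apply: complexI; rewrite -(rowE y B b Bu) -FB mulmx_sumr mulmx_suml summxE.
  by rewrite rmorph_sum; apply: eq_bigr => k _; rewrite specmx_quadR.
have y0 b : 0 <= y b.
  rewrite yE; apply: sumr_ge0 => k _; apply: sumr_ge0 => i _.
  by rewrite mulr_ge0 ?normsq_ge0 // fge0 // sqrtr_ge0.
have hinge t : \sum_j Num.max 0 (f (sg j) - t) <= \sum_b Num.max 0 (y b - t).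
  have hf := concave_hinge f0 fm cf Pu Qu Bu sg0 SS FB.
  (* Below [f 0] every entry on both sides exceeds the threshold, so both sums are affine in [t]
     with the same slope, and the case [t = f 0] suffices. *)
  have [ft|tf] := leP (f 0) t; first exact: hf.
  have yf b : f 0 <= y b.
    rewrite yE.
    have fk k : f 0 <= \sum_i f (a k i) * normsq ((B *m (P k)^t*) b i).
      rewrite -[f 0]mulr1.
      have <- : \sum_i normsq ((B *m (P k)^t*) b i) = 1.
        by apply: complexI; rewrite sum_normsq (parseval _ _ (Pu k)) (unitarymx_row_norm _ Bu).
      rewrite mulr_sumr; apply: ler_sum => i _.
      by rewrite ler_wpM2r ?normsq_ge0 // fle // sqrtr_ge0.
    (* A single summand already reaches [f 0], since its weights sum to one; [m0] provides it. *)
    rewrite (bigD1 (Ordinal m0)) //=; apply: le_trans (fk (Ordinal m0)) _.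
    by rewrite lerDl sumr_ge0 // => k _; apply: le_trans (fk k); exact: fge0.
  have sf j : f 0 <= f (sg j) by exact: fle.
  have := hf _ (lexx (f 0)).
  have maxE (z : 'I_d -> R) (r : R) : (forall j, f 0 <= z j) -> r <= f 0 ->
      \sum_j Num.max 0 (z j - r) = \sum_j z j - d%:R * r.
    move=> zf rf; rewrite mulr_natl -[in r *+ d](card_ord d) -sumr_const -sumrB.
    by apply: eq_bigr => j _; rewrite max_r // subr_ge0 (le_trans rf).
  by rewrite !maxE // ?(ltW tf) // lerD2r lerD2r.
have [U [UU Ux]] := horn hinge.
pose UC := map_mx (real_complex R) U.
have UCu : UC^t* \is unitarymx.
  apply/unitarymxP; rewrite trmxCK.
  have -> : UC^t* = map_mx (real_complex R) U^T.
    by apply/matrixP => i j; rewrite trmxCE !mxE; exact: conjc_real.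
  by rewrite -map_mxM UU map_mx1.
rewrite trmxC_unitary in UCu.
(* The squared entries of column [j] of [U] are weights for which the mean of [y] dominates
   [f (sg j)]. *)
have gE j : 0 <= \sum_i U i j ^+ 2 * g (y i) - g (f (sg j)).
  rewrite subr_ge0; apply: jensen_nondecreasing => //.
  - by move=> i; exact: sqr_ge0.
  - have /matrixP/(_ j j) := UU; rewrite !mxE eqxx mulr1n => <-.
    by apply: eq_bigr => i _; rewrite mxE.
  - exact: fge0.
have [V [Vu VE]] := unitary_average (rowC ((g \o f) \o sg)) (rowC (g \o y)) d0 Qu Bu UCu.
exists V; split=> //.
rewrite SE FE /loewner_le.
have -> : absmx S = specmx Q (rowC sg).
  have S2abs : absmx S = funmx (@Num.sqrt R) S2 := erefl _.
  rewrite S2abs {1}S2E; exact: (funmx_specmx _ _ Qu).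
have -> : funmx g F = specmx B (rowC (g \o y)) by rewrite {1}FB; exact: (funmx_specmx _ _ Bu).
(* The difference of the two sides is now diagonal in the eigenbasis [Q] of [absmx S], with the
   entries bounded in [gE]. *)
rewrite (funmx_specmx _ _ Qu) VE.
have -> : (\row_j (\sum_i rowC (g \o y) 0 i * `|UC i j| ^+ 2 -
      rowC ((g \o f) \o sg) 0 j)) =
    rowC (fun j => \sum_i U i j ^+ 2 * g (y i) - g (f (sg j))).
  apply/rowP => j; rewrite [LHS]mxE [RHS]mxE rmorphB rmorph_sum; congr (_ - _).
    apply: eq_bigr => i _; rewrite !mxE -add_Re2_Im2 [RHS]rmorphM /= mulrC.
    by rewrite expr0n addr0.
  by rewrite mxE.
split; first by apply/selfadj_hermsymmx/trmxC_specmx; exact: rowC_real.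
by move=> v; apply: specmx_ge0 => j; rewrite mxE ler0c.
Qed.
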